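(* Let $r\ge1$, $n\ge2r$, and suppose $d_{n,r}=\binom nr-\binom n{r-1}\ge2$. Let $A,B\in\mathcal V_{n,r}$ be such that $\mathcal U_{n,r}A$ and $\mathcal U_{n,r}B$ are nonzero, and define $$R^{\mathrm{sub}}_{n,r}(A,B)=\frac{\langle\mathcal U_{n,r}A,\mathcal U_{n,r}B\rangle}{\|\mathcal U_{n,r}A\|\,\|\mathcal U_{n,r}B\|}.$$ Let $\mathbf a,\mathbf b\in\mathbb R^{\binom nr}$ be the coordinate vectors of $A,B$, and let $W_{<r}\in\mathbb R^{\binom nr\times\binom n{r-1}}$ be a full-column-rank matrix whose column space is the lower-order ANOVA space $\mathcal L_{n,r}$. If $|R^{\mathrm{sub}}_{n,r}(A,B)|<1$, then the ordinary least-squares $t$-statistic for testing $H_0:\beta=0$ in the linear model $$\mathbf b=W_{<r}\gamma+\beta\mathbf a+\mathbf e,\qquad \gamma\in\mathbb R^{\binom n{r-1}},\ \beta\in\mathbb R,$$ is $$T^{\mathrm{slope}}_{n,r}=\frac{\sqrt{d_{n,r}-1}\;R^{\mathrm{sub}}_{n,r}(A,B)}{\{1-(R^{\mathrm{sub}}_{n,r}(A,B))^2\}^{1/2}},$$ and the full-model residual degrees of freedom are $d_{n,r}-1$.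
   Context: Let $[n]=\{1,\dots,n\}$, let $\binom{[n]}j$ be the set of $j$-element subsets of $[n]$, $\mathcal I_{n,r}=\binom{[n]}r$, and $\mathcal V_{n,r}=\mathbb R^{\mathcal I_{n,r}}$ with inner product $\langle A,B\rangle=\sum_{I\in\mathcal I_{n,r}}A_IB_I$ and norm $\|A\|=\langle A,A\rangle^{1/2}$; fixing an ordering of $\mathcal I_{n,r}$ identifies $\mathcal V_{n,r}$ with $\mathbb R^{\binom nr}$. For $0\le j\le r$, $(D_{j,r}A)(J)=\sum_{I\in\mathcal I_{n,r},\,I\supseteq J}A_I$ for $J\in\binom{[n]}j$, with adjoint $(D_{j,r}^*f)(I)=\sum_{J\subseteq I,\,|J|=j}f(J)$. The lower-order ANOVA space is $\mathcal L_{n,r}=\operatorname{range}(D^*_{r-1,r})$, which has dimension $\binom n{r-1}$. Higher-order U-centering is $$\mathcal U_{n,r}A=\sum_{j=0}^r\frac{(-1)^{r-j}}{\binom{n-r-j+1}{r-j}}D_{j,r}^*D_{j,r}A.$$ The ordinary least-squares $t$-statistic for $\beta$ is $\widehat\beta$ divided by its usual homoskedastic standard error $\sqrt{(\mathrm{RSS}/\nu)\,[(D^{\mathsf T}D)^{-1}]_{\beta\beta}}$, where $D=[W_{<r}\ \mathbf a]$ is the full design matrix, $\mathrm{RSS}$ is the residual sum of squares, and $\nu=\binom nr-\operatorname{rank}(D)$ is the full-model residual degrees of freedom. *)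

(* Defs.v *)
From HB Require Import structures.
From mathcomp Require Import all_boot all_order all_algebra.
From mathcomp Require Import reals.

Set Implicit Arguments.
Unset Strict Implicit.
Unset Printing Implicit Defensive.

Import Order.TTheory GRing.Theory Num.Theory.
Local Open Scope ring_scope.

(* The set [n] = {1, ..., n} is represented by 'I_n. *)
Definition ksub (n j : nat) := {J : {set 'I_n} | #|J| == j}.

Section Anova.

Variables (R : realType) (n : nat).

Definition inner (r : nat) (A B : {ffun ksub n r -> R}) : R :=
  \sum_(I : ksub n r) A I * B I.

Definition norm2 (r : nat) (A : {ffun ksub n r -> R}) : R :=
  Num.sqrt (inner A A).

Definition down (j r : nat) (A : {ffun ksub n r -> R}) : {ffun ksub n j -> R} :=
  [ffun J : ksub n j => \sum_(I : ksub n r | val J \subset val I) A I].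

Definition down_adj (j r : nat) (f : {ffun ksub n j -> R}) :
    {ffun ksub n r -> R} :=
  [ffun I : ksub n r => \sum_(J : ksub n j | val J \subset val I) f J].

(* Membership in range(D_{r-1,r}^* ). *)
Definition lower_anova (r : nat) (A : {ffun ksub n r -> R}) : Prop :=
  exists f : {ffun ksub n r.-1 -> R}, A = down_adj r f.

(* When 2 r <= n and j <= r the truncated subtraction in n - r - j is exact. *)
Definition ucenter (r : nat) (A : {ffun ksub n r -> R}) :
    {ffun ksub n r -> R} :=
  [ffun I : ksub n r => \sum_(j < r.+1)
     (-1) ^+ (r - j) / 'C(n - r - j + 1, r - j)%:R
       * down_adj r (down j A) I].

Definition Rsub (r : nat) (A B : {ffun ksub n r -> R}) : R :=
  inner (ucenter A) (ucenter B) / (norm2 (ucenter A) * norm2 (ucenter B)).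

(* Coordinates with respect to an ordering e of the r-subsets. *)
Definition coord_vec (r N : nat) (e : 'I_N -> ksub n r)
    (A : {ffun ksub n r -> R}) : 'cV[R]_N :=
  \col_i A (e i).

End Anova.

Definition dim_top (n r : nat) : nat := 'C(n, r) - 'C(n, r.-1).

Section OLS.

Variables (R : realType) (m k : nat).

Definition rss (X : 'M[R]_(m, k)) (y : 'cV[R]_m) (theta : 'cV[R]_k) : R :=
  \sum_(i < m) (y i 0 - (X *m theta) i 0) ^+ 2.

Definition is_ols (X : 'M[R]_(m, k)) (y : 'cV[R]_m) (theta : 'cV[R]_k) : Prop :=
  forall theta' : 'cV[R]_k, rss X y theta <= rss X y theta'.

Definition resid_df (X : 'M[R]_(m, k)) : nat := m - \rank X.

Definition std_err (X : 'M[R]_(m, k)) (y : 'cV[R]_m) (theta : 'cV[R]_k)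
    (j : 'I_k) : R :=
  Num.sqrt (rss X y theta / (resid_df X)%:R * invmx (X^T *m X) j j).

(* The t-statistic of coefficient j is well defined and equal to t: invertibility
   of X^T X makes the least-squares minimizer, hence t, unique and rules out the
   convention invmx M = M for singular M; the two positivity conditions rule out
   the convention x / 0 = 0. *)
Definition is_ols_tstat (X : 'M[R]_(m, k)) (y : 'cV[R]_m) (j : 'I_k) (t : R) :
    Prop :=
  X^T *m X \in unitmx /\
  exists theta : 'cV[R]_k,
    [/\ is_ols X y theta,
        (0 < resid_df X)%N,
        0 < std_err X y theta j
      & t = theta j 0 / std_err X y theta j].

End OLS.

(* Main.v *)
(** Write u and v for the coordinate vectors of U A and U B.  The operator U is
    the orthogonal projection onto the complement of the lower-order ANOVA
    space: every term of U with j < r has its values in that space and the term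
    j = r is the identity, while D_{r-1,r} U = 0 because the coefficients make a
    sum over j telescope.  Hence A and B are u and v plus elements of the column
    space of W, with u and v orthogonal to it, so regressing B on (W, A) has
    slope <u,v>/<u,u>, residual v - slope * u, and 1/<u,u> as the slope entry of
    the inverse Gram matrix (Frisch-Waugh-Lovell). *)

Require Import Defs.
From HB Require Import structures.
From mathcomp Require Import all_boot all_order all_algebra.
From mathcomp Require Import reals ring zify.

Set Implicit Arguments.
Unset Strict Implicit.
Unset Printing Implicit Defensive.

Import Order.TTheory GRing.Theory Num.Theory.
Local Open Scope ring_scope.

(** * Sums over subsets of fixed size *)

Lemma sum_ksub (R : nmodType) (n j : nat) (P : pred {set 'I_n})
    (F : {set 'I_n} -> R) :
  \sum_(I : ksub n j | P (val I)) F (val I) = \sum_(I : {set 'I_n} | (#|I| == j) && P I) F I.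
Proof.
rewrite (reindex_omap (val : ksub n j -> _) insub) => [|I /andP[hI _]]; last by rewrite insubT.
by apply: eq_bigl => I; rewrite valK eqxx andbT (valP I).
Qed.

Lemma card_ksub_subset (n j : nat) (S : {set 'I_n}) :
  (\sum_(J : ksub n j | val J \subset S) 1)%N = 'C(#|S|, j).
Proof.
rewrite (sum_ksub j (fun J => J \subset S) (fun=> 1%N)) -cards_draws -sum1_card.
by apply: eq_bigl => J; rewrite inE andbC.
Qed.

Lemma sum_ksub_superset (R : nmodType) (n r : nat) (K : {set 'I_n})
    (F : {set 'I_n} -> R) : #|K|.+1 = r ->
  \sum_(I : ksub n r | K \subset val I) F (val I) = \sum_(x in ~: K) F (x |: K).
Proof.
move=> hK; rewrite (sum_ksub r (fun I => K \subset I) F).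
rewrite -(big_imset F (h := fun x => x |: K)) /=; last first.
  move=> x y; rewrite !inE => hx hy /setP /(_ x).
  by rewrite !inE eqxx (negbTE hx) !orbF => /esym/eqP.
apply: eq_bigl => I; apply/andP/imsetP => [[/eqP hI hKI]|[x]].
  have : #|I :\: K| == 1%N by rewrite cardsD (setIidPr hKI) hI -hK subSnn.
  move=> /cards1P [x hx]; exists x.
    have : x \in I :\: K by rewrite hx set11.
    by rewrite !inE => /andP[].
  by rewrite -hx setUC -{1}(setIidPr hKI) setID.
by rewrite inE => hx ->; rewrite cardsU1 hx add1n hK eqxx subsetUr.
Qed.

Lemma sum_ksub_pred_subset (R : nmodType) (n r : nat) (I : {set 'I_n})
    (F : {set 'I_n} -> R) : #|I| = r.+1 ->
  \sum_(K : ksub n r | val K \subset I) F (val K) = \sum_(x in I) F (I :\ x).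
Proof.
move=> hI; rewrite (sum_ksub r (fun K => K \subset I) F).
rewrite -(big_imset F (h := fun x => I :\ x)) /=; last first.
  move=> x y hx hy /setP /(_ x).
  by rewrite !inE eqxx hx !andbT => /esym/negbFE/eqP.
apply: eq_bigl => K; apply/andP/imsetP => [[/eqP hK hKI]|[x hx ->]].
  have /cards1P[x hx] : #|I :\: K| == 1%N.
    by rewrite cardsD (setIidPr hKI) hI hK subSnn.
  exists x.
    have : x \in I :\: K by rewrite hx set11.
    by rewrite !inE => /andP[].
  by rewrite -hx setDDr setDv set0U (setIidPr hKI).
by rewrite subD1set; split=> //; rewrite -eqSS -hI (cardsD1 x I) hx.
Qed.

(** * U-centering as a projection with kernel the lower-order space *)

Section Centering.

Variables (R : realType) (n : nat).

(** After exchanging sums, [A I'] is counted once for each j-subset of the intersection of [I] and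
    [I']. *)
Lemma down_adj_down (j r : nat) (A : {ffun ksub n r -> R}) (I : ksub n r) :
  down_adj r (down j A) I =
  \sum_(I' : ksub n r) A I' * 'C(#|val I :&: val I'|, j)%:R.
Proof.
rewrite ffunE; under eq_bigr do rewrite ffunE.
rewrite (exchange_big_dep predT) //=; apply: eq_bigr => I' _.
rewrite sumr_const mulr_natr -card_ksub_subset -sum1_card; congr (_ *+ _).
by apply: eq_bigl => J; rewrite unfold_in /= subsetI.
Qed.

Lemma inner_down_adj (j r : nat) (A : {ffun ksub n r -> R})
    (f : {ffun ksub n j -> R}) :
  inner A (down_adj r f) = inner (down j A) f.
Proof.
rewrite /inner; under eq_bigr do rewrite ffunE mulr_sumr.
rewrite (exchange_big_dep predT) //=; apply: eq_bigr => J _.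
by rewrite ffunE mulr_suml.
Qed.

(** A j-set J inside I survives in I minus x exactly for the r - j points x of I outside J. This
    puts every term of U with j < r into the lower-order space. *)
Lemma down_adj_comp (j r : nat) (f : {ffun ksub n j -> R}) (I : ksub n r) :
  (j < r)%N -> down_adj r (down_adj r.-1 f) I = (r - j)%:R * down_adj r f I.
Proof.
case: r I => // r I _; have hI := eqP (valP I).
transitivity (\sum_(K : ksub n r | val K \subset val I)
    \sum_(J : ksub n j | val J \subset val K) f J).
  by rewrite ffunE; apply: eq_bigr => K _; rewrite ffunE.
rewrite (sum_ksub_pred_subset
  (fun K => \sum_(J : ksub n j | val J \subset K) f J) hI).
rewrite ffunE (exchange_big_dep (fun J : ksub n j => val J \subset val I)) /=; last first.
  by move=> x J _; rewrite subsetD1 => /andP[].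
rewrite mulr_sumr; apply: eq_bigr => J hJ; rewrite sumr_const mulr_natl.
congr (_ *+ _).
transitivity #|val I :\: val J|; last by rewrite cardsDS // hI (eqP (valP J)).
by apply: eq_card => x; rewrite [LHS]unfold_in /= !inE subsetD1 hJ andbC.
Qed.

Definition ucoef (r j : nat) : R :=
  (-1) ^+ (r - j) / 'C(n - r - j + 1, r - j)%:R.

(** Kernel of U: its entry at (I, I') depends only on the intersection size s, as in the Johnson
    scheme. *)
Definition uweight (r s : nat) : R := \sum_(j < r.+1) ucoef r j * 'C(s, j)%:R.

Lemma ucenter_weight (r : nat) (A : {ffun ksub n r -> R}) (I : ksub n r) :
  ucenter A I = \sum_(I' : ksub n r) uweight r #|val I :&: val I'| * A I'.
Proof.
rewrite ffunE; under eq_bigr do rewrite down_adj_down mulr_sumr.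
rewrite exchange_big; apply: eq_bigr => I' _; rewrite mulr_suml.
by apply: eq_bigr => j _; rewrite mulrA mulrAC.
Qed.

Lemma ucoef_step (r j : nat) : (2 * r <= n)%N -> (j < r)%N ->
  ucoef r j * (n - r - j).+1%:R = - ucoef r j.+1 * (r - j)%:R.
Proof.
move=> hn hj; rewrite /ucoef -[(r - j)%N](subnSK hj).
(* With m = n - r - j and k = r - j - 1, the two coefficients have denominators C(m+1, k+1) and C(m,
   k), related by (m+1) C(m, k) = (k+1) C(m+1, k+1). *)
have -> : (n - r - j + 1 = (n - r - j.+1 + 1).+1)%N by lia.
have -> : (n - r - j).+1 = (n - r - j.+1 + 1).+1 by lia.
set m := (n - r - j.+1 + 1)%N; set k := (r - j.+1)%N.
have /(congr1 (fun i => i%:R : R)) := mul_bin_diag m.+1 k; rewrite /= !natrM => hb.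
have hk : (k <= m)%N by rewrite /m /k; lia.
have h1 : 'C(m, k)%:R != 0 :> R by rewrite pnatr_eq0 -lt0n bin_gt0.
have h2 : 'C(m.+1, k.+1)%:R != 0 :> R by rewrite pnatr_eq0 -lt0n bin_gt0.
apply: (mulIf h1); apply: (mulIf h2).
rewrite exprS.
transitivity (- (-1) ^+ k * (m.+1%:R * 'C(m, k)%:R) : R); first by field.
by rewrite hb; field.
Qed.

(** For j > 0 the bracket equals (n-r-j+1) C(t, j) + (r-j+1) C(t, j-1), and by [ucoef_step] the
    second part cancels the partial sum up to j - 1. At m = r the closed form vanishes, since t <
    r. *)
Lemma uweight_partial (r t m : nat) : (2 * r <= n)%N -> (t < r)%N -> (m <= r)%N ->
  \sum_(j < m.+1) ucoef r j *
     ((r - t)%:R * 'C(t.+1, j)%:R + (n - 2 * r + 1 + t)%:R * 'C(t, j)%:R) =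
  ucoef r m * (n - r - m).+1%:R * 'C(t, m)%:R.
Proof.
move=> hn ht; elim: m => [_|m IH hm].
  rewrite big_ord1 !bin0 !mulr1 -natrD; congr (_ * _%:R); lia.
have key : ((r - t) * 'C(t.+1, m.+1) + (n - 2 * r + 1 + t) * 'C(t, m.+1) =
    (n - r - m.+1).+1 * 'C(t, m.+1) + (r - m) * 'C(t, m))%N.
  (* Pascal's rule and (m+1) C(t, m+1) = (t-m) C(t, m). If t < m the subtraction truncates, but both
     binomials are then zero. *)
  rewrite binS; have := mul_bin_left t m.
  case: (leqP m t) => hmt hb; last first.
    by rewrite (bin_small hmt) (@bin_small t m.+1) ?ltnS 1?ltnW //; lia.
  nia.
rewrite big_ord_recr /= IH 1?ltnW // ucoef_step // -!natrM -natrD key natrD !natrM.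
ring.
Qed.

(* A set K of size r - 1 with #|K :&: I'| = t, for #|I'| = r, has r - t
   one-point extensions by elements of I' and n - 2r + 1 + t others. *)
Lemma uweight_rec (r t : nat) : (2 * r <= n)%N -> (t < r)%N ->
  (r - t)%:R * uweight r t.+1 + (n - 2 * r + 1 + t)%:R * uweight r t = 0.
Proof.
move=> hn ht; have := uweight_partial hn ht (leqnn r).
rewrite (bin_small ht) mulr0 => <-; rewrite /uweight !mulr_sumr -big_split.
by apply: eq_bigr => j _ /=; ring.
Qed.

Lemma down_ucenter (r : nat) (A : {ffun ksub n r -> R}) :
  (0 < r)%N -> (2 * r <= n)%N -> down r.-1 (ucenter A) = 0.
Proof.
case: r A => // r A _ hn; apply/ffunP => K; have hK : #|val K| = r := eqP (valP K).
rewrite !ffunE; under eq_bigr do rewrite ucenter_weight.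
rewrite exchange_big big1 // => I' _ /=; rewrite -mulr_suml.
rewrite (sum_ksub_superset (fun I => uweight r.+1 #|I :&: val I'|)) ?hK //.
(* The coefficient of [A I'] is now a sum over one-point extensions of K, whose weight is that of t
   + 1 or t according to whether the new point lies in I'. Here K has size r and I' has size r +
   1. *)
set t := #|val K :&: val I'|.
have ht : (t < r.+1)%N by rewrite ltnS -hK subset_leq_card // subsetIl.
have hin x : (x \in ~: val K) && (x \in val I') ->
    uweight r.+1 #|(x |: val K) :&: val I'| = uweight r.+1 t.+1.
  rewrite inE => /andP[hxK hxI]; rewrite setIUl.
  have -> : [set x] :&: val I' = [set x] by apply/setIidPl; rewrite sub1set.
  by rewrite cardsU1 inE (negbTE hxK).
have hout x : (x \in ~: val K) && (x \notin val I') ->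
    uweight r.+1 #|(x |: val K) :&: val I'| = uweight r.+1 t.
  move=> /andP[_ hxI]; rewrite setIUl.
  have -> : [set x] :&: val I' = set0.
    by apply/eqP; rewrite setI_eq0 disjoints1.
  by rewrite set0U.
have hI' := eqP (valP I').
have cin (w : R) :
    \sum_(x in ~: val K | x \in val I') w = (r.+1 - t)%:R * w.
  transitivity (\sum_(x in val I' :\: val K) w).
    by apply: eq_bigl => x; rewrite !inE.
  by rewrite sumr_const mulr_natl cardsD hI' /t setIC.
have cout (w : R) :
    \sum_(x in ~: val K | x \notin val I') w = (n - 2 * r.+1 + 1 + t)%:R * w.
  transitivity (\sum_(x in ~: (val K :|: val I')) w).
    by apply: eq_bigl => x; rewrite !inE negb_or.
  rewrite sumr_const mulr_natl; congr (_ *+ _).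
  have := cardsC (val K :|: val I'); rewrite cardsU hK hI' card_ord -/t.
  have : (t <= r)%N by [].
  lia.
rewrite (bigID (fun x => x \in val I')) /=.
transitivity ((\sum_(x in ~: val K | x \in val I') uweight r.+1 t.+1 +
  \sum_(x in ~: val K | x \notin val I') uweight r.+1 t) * A I').
  by congr ((_ + _) * _); apply: eq_bigr => x; [apply: hin | apply: hout].
by rewrite cin cout uweight_rec // mul0r.
Qed.

Lemma lower_anova_sub_ucenter (r : nat) (A : {ffun ksub n r -> R}) :
  (0 < r)%N -> lower_anova (A - ucenter A).
Proof.
(* The preimage takes each term j < r of U one level down, to (r-1)-sets; dividing by r - j undoes
   the factor of [down_adj_comp]. *)
move=> hr; exists (\sum_(j < r) [ffun K =>
   - (ucoef r j / (r - j)%:R) * down_adj r.-1 (down j A) K]).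
apply/ffunP => I.
have hlin (s : R) (g : {ffun ksub n r.-1 -> R}) :
    down_adj r [ffun K => s * g K] I = s * down_adj r g I.
  by rewrite !ffunE mulr_sumr; apply: eq_bigr => K _; rewrite ffunE.
have -> : down_adj r (\sum_(j < r) [ffun K =>
   - (ucoef r j / (r - j)%:R) * down_adj r.-1 (down j A) K]) I =
   \sum_(j < r) - (ucoef r j / (r - j)%:R) * down_adj r (down_adj r.-1 (down j A)) I.
  rewrite ffunE; under eq_bigr do rewrite sum_ffunE.
  rewrite exchange_big; apply: eq_bigr => j _.
  by rewrite -hlin [RHS]ffunE.
rewrite !ffunE big_ord_recr /= subnn expr0 bin0 divr1 mul1r down_adj_down.
(* Two r-sets meet in r points only if they coincide, so the j = r term is the identity. *)
have -> : \sum_(I' : ksub n r) A I' * 'C(#|val I :&: val I'|, r)%:R = A I.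
  rewrite (bigD1 I) //= setIid (eqP (valP I)) binn mulr1 big1 ?addr0 // => I' hI'.
  have ltIr : (#|val I :&: val I'| < r)%N; last by rewrite bin_small ?mulr0.
  rewrite -[X in (_ < X)%N](eqP (valP I)) ltn_neqAle.
  rewrite subset_leq_card ?subsetIl // andbT; apply: contra hI' => /eqP h.
  have hs : val I :&: val I' = val I by apply/eqP; rewrite eqEcard subsetIl h (eqP (valP I)) leqnn.
  apply/eqP/val_inj/eqP; rewrite eq_sym eqEcard (eqP (valP I)) (eqP (valP I')) leqnn andbT.
  by apply/setIidPl.
rewrite opprD addrCA subrr addr0 -sumrN; apply: eq_bigr => j _.
rewrite down_adj_comp // mulrA [X in _ = X * _]mulNr.
by rewrite divfK ?pnatr_eq0 ?subn_eq0 -?ltnNge // mulNr.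
Qed.

End Centering.

(** * Dot products, Gram matrices and normal equations *)

Definition cdot (R : pzRingType) (m : nat) (u v : 'cV[R]_m) : R := (u^T *m v) 0 0.

Section Ols.

Variables (R : realType) (m : nat).
Implicit Types u v : 'cV[R]_m.

Lemma cdotE u v : cdot u v = \sum_i u i 0 * v i 0.
Proof. by rewrite /cdot mxE; apply: eq_bigr => i _; rewrite mxE. Qed.

Lemma cdotC u v : cdot u v = cdot v u.
Proof. by rewrite !cdotE; apply: eq_bigr => i _; rewrite mulrC. Qed.

Lemma cdotDl u v w : cdot (u + v) w = cdot u w + cdot v w.
Proof.
by rewrite !cdotE -big_split; apply: eq_bigr => i _; rewrite mxE mulrDl.
Qed.

Lemma cdotDr u v w : cdot w (u + v) = cdot w u + cdot w v.
Proof. by rewrite cdotC cdotDl !(cdotC w). Qed.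

Lemma cdotZl c u v : cdot (c *: u) v = c * cdot u v.
Proof. by rewrite !cdotE mulr_sumr; apply: eq_bigr => i _; rewrite mxE mulrA. Qed.

Lemma cdotZr c u v : cdot u (c *: v) = c * cdot u v.
Proof. by rewrite cdotC cdotZl cdotC. Qed.

Lemma mx11_cdot u v : u^T *m v = (cdot u v)%:M.
Proof. exact: mx11_scalar. Qed.

Lemma cdot_ge0 u : 0 <= cdot u u.
Proof. by rewrite cdotE sumr_ge0 // => i _; rewrite -expr2 sqr_ge0. Qed.

Lemma cdot_eq0 u : cdot u u = 0 -> u = 0.
Proof.
rewrite cdotE => /psumr_eq0P h; apply/colP => i; rewrite mxE.
have /eqP := h (fun j _ => sqr_ge0 (u j 0)) i isT.
by rewrite mulf_eq0 orbb => /eqP.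
Qed.

(** A row w killed by the Gram matrix gives w X^T squared norm 0. *)
Lemma gram_unit k (X : 'M[R]_(m, k)) : row_free X^T -> X^T *m X \in unitmx.
Proof.
move=> hX; rewrite -row_free_unit -kermx_eq0; apply/rowV0P => w /sub_kermxP hw.
apply/eqP; rewrite -(mulmx_free_eq0 _ hX) -trmx_eq0; apply/eqP/cdot_eq0.
by rewrite /cdot trmxK trmx_mul trmxK -mulmxA (mulmxA X^T) mulmxA hw mul0mx mxE.
Qed.

Lemma rss_cdot k (X : 'M[R]_(m, k)) (y : 'cV[R]_m) (theta : 'cV[R]_k) :
  rss X y theta = cdot (y - X *m theta) (y - X *m theta).
Proof. by rewrite cdotE; apply: eq_bigr => i _; rewrite !mxE expr2. Qed.

(** Pythagoras: changing [theta] adds to the residual a vector of the column space, orthogonal to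
    it. *)
Lemma normal_eq_is_ols k (X : 'M[R]_(m, k)) (y : 'cV[R]_m) (theta : 'cV[R]_k) :
  X^T *m (y - X *m theta) = 0 -> is_ols X y theta.
Proof.
move=> hn theta'; rewrite !rss_cdot; set e := y - X *m theta.
have -> : y - X *m theta' = e + X *m (theta - theta').
  by rewrite mulmxBr /e addrA subrK.
set w := theta - theta'.
have hew : cdot e (X *m w) = 0.
  by rewrite cdotC /cdot trmx_mul -mulmxA hn mulmx0 mxE.
have -> : cdot (e + X *m w) (e + X *m w) = cdot e e + cdot (X *m w) (X *m w).
  clearbody e w; by rewrite cdotDl !cdotDr [cdot (X *m w) e]cdotC hew addr0 add0r.
by rewrite lerDl cdot_ge0.
Qed.

(** * Regression on W and one further column *)

Section Slope.

Variables (k : nat) (W : 'M[R]_(m, k)) (u v : 'cV[R]_m) (g h : 'cV[R]_k).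
Hypotheses (hW : \rank W = k) (hu : u != 0).
Hypotheses (Wu : W^T *m u = 0) (Wv : W^T *m v = 0).

(** The last regressor comes already split into u, orthogonal to W, and a combination of columns of
    W; the response will be v + W h in the same way. *)
Let X := row_mx W (u + W *m g).

Let uu_neq0 : cdot u u != 0.
Proof. by apply: contra hu => /eqP/cdot_eq0/eqP. Qed.

Let au (w : 'cV[R]_m) : W^T *m w = 0 -> (u + W *m g)^T *m w = (cdot u w)%:M.
Proof.
move=> Ww; rewrite linearD /= trmx_mul mulmxDl -mulmxA Ww mulmx0 addr0.
exact: mx11_cdot.
Qed.

Lemma row_free_slope : row_free X^T.
Proof.
rewrite -kermx_eq0; apply/rowV0P => w /sub_kermxP.
rewrite tr_row_mx -{1}[w]hsubmxK mul_row_col => hw.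
(* Multiplying by u kills the W block and leaves the last coefficient times the nonzero
   [cdot u u]. *)
have w2 : rsubmx w = 0.
  have := congr1 (mulmx^~ u) hw; rewrite /= mulmxDl -!mulmxA Wu mulmx0 add0r.
  rewrite au // mul_mx_scalar mul0mx => /eqP.
  by rewrite scaler_eq0 (negbTE uu_neq0) => /eqP.
have fW : row_free W^T by rewrite /row_free mxrank_tr hW.
move: hw; rewrite w2 mul0mx addr0 => /eqP; rewrite mulmx_free_eq0 // => /eqP w1.
by rewrite -[w]hsubmxK w1 w2 row_mx0.
Qed.

Lemma resid_df_slope : resid_df X = (m - (k + 1))%N.
Proof. by rewrite /resid_df -mxrank_tr (eqP row_free_slope). Qed.

Lemma invmx_gram_slope :
  invmx (X^T *m X) (rshift k 0) (rshift k 0) = (cdot u u)^-1.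
Proof.
(* Last column of the inverse Gram matrix: the entry -g removes W g from the regressor, so X z is u
   scaled to have product 1 with the last column of X and 0 with W. *)
pose z : 'cV[R]_(k + 1) := (cdot u u)^-1 *: col_mx (- g) 1%:M.
have Xz : X *m z = (cdot u u)^-1 *: u.
  rewrite -scalemxAr mul_row_col mulmxN mulmx1; congr (_ *: _).
  by rewrite addrC addrK.
have Gz : X^T *m X *m z = delta_mx (rshift k 0) 0.
  rewrite -mulmxA Xz -scalemxAr tr_row_mx mul_col_mx Wu au //.
  rewrite scale_col_mx scaler0 scale_scalar_mx mulVf //.
  apply/colP => i; rewrite !mxE; case: (splitP i) => j hj.
    rewrite mxE eqxx andbT; case: eqP => // hi.
    by have := congr1 val hi; rewrite /= hj; have := ltn_ord j; lia.
  have -> : i = rshift k 0 by apply/val_inj; rewrite /= hj (ord1 j).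
  by rewrite (ord1 j) mxE !eqxx.
have -> : invmx (X^T *m X) (rshift k 0) (rshift k 0) = z (rshift k 0) 0.
  rewrite -[z]mul1mx -(mulVmx (gram_unit row_free_slope)) -mulmxA Gz.
  by rewrite -colE mxE.
by rewrite mxE col_mxEd mxE eqxx mulr1.
Qed.

Lemma slope_is_ols_tstat :
  let rho := cdot u v / (Num.sqrt (cdot u u) * Num.sqrt (cdot v v)) in
  v != 0 -> `|rho| < 1 -> (k + 1 < m)%N ->
  is_ols_tstat X (v + W *m h) (rshift k 0)
    (Num.sqrt (m - (k + 1))%N%:R * rho / Num.sqrt (1 - rho ^+ 2)).
Proof.
move=> rho hv hrho hm; split; first exact: gram_unit row_free_slope.
pose b := cdot u v / cdot u u.
(* The W-coefficients absorb h and the b g brought in by the last regressor, leaving the residual v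
   - b u. *)
pose theta : 'cV[R]_(k + 1) := col_mx (h - b *: g) b%:M.
have hres : v + W *m h - X *m theta = v - b *: u.
  rewrite mul_row_col mul_mx_scalar mulmxBr -scalemxAr scalerDr.
  by rewrite (addrC (b *: u)) addrA subrK opprD addrA addrK.
have uu0 : 0 < cdot u u by rewrite lt_def uu_neq0 cdot_ge0.
have vv0 : 0 < cdot v v.
  by rewrite lt_def cdot_ge0 andbT; apply: contra hv => /eqP/cdot_eq0/eqP.
have hols : is_ols X (v + W *m h) theta.
  apply: normal_eq_is_ols; rewrite hres tr_row_mx mul_col_mx mulmxBr -scalemxAr.
  rewrite Wu Wv scaler0 subr0 au; last by rewrite mulmxBr -scalemxAr Wu Wv scaler0 subr0.
  by rewrite -scaleNr cdotDr cdotZr mulNr divfK // subrr raddf0 col_mx0.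
set su := Num.sqrt (cdot u u); set sv := Num.sqrt (cdot v v).
have su0 : 0 < su by rewrite sqrtr_gt0.
have sv0 : 0 < sv by rewrite sqrtr_gt0.
have suE : cdot u u = su ^+ 2 by rewrite sqr_sqrtr ?ltW.
have svE : cdot v v = sv ^+ 2 by rewrite sqr_sqrtr ?ltW.
have uvE : cdot u v = rho * (su * sv).
  by rewrite /rho divfK // mulf_neq0 // lt0r_neq0.
have bE : b = rho * sv / su by rewrite /b uvE suE; field; rewrite lt0r_neq0.
clearbody rho su sv.
have hrss : rss X (v + W *m h) theta = sv ^+ 2 * (1 - rho ^+ 2).
  rewrite rss_cdot hres.
  have -> : cdot (v - b *: u) (v - b *: u) =
      cdot v v - b * cdot u v *+ 2 + b ^+ 2 * cdot u u.
    rewrite -scaleNr cdotDl !cdotDr !cdotZl !cdotZr (cdotC v u); ring.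
  rewrite uvE suE svE bE; field; rewrite lt0r_neq0 //.
have rho2 : 0 < 1 - rho ^+ 2.
  by rewrite subr_gt0 -real_normK ?num_real // expr_lt1 // ?normr_ge0.
set nu := (m - (k + 1))%N; have nu0 : 0 < nu%:R :> R by rewrite ltr0n subn_gt0.
have hse : std_err X (v + W *m h) theta (rshift k 0) =
    sv * Num.sqrt (1 - rho ^+ 2) / (Num.sqrt nu%:R * su).
  rewrite /std_err hrss invmx_gram_slope resid_df_slope -/nu suE.
  (* The right side is nonnegative, hence the root of its square; it remains to compare
     radicands. *)
  rewrite -[RHS]ger0_norm ?divr_ge0 ?mulr_ge0 ?sqrtr_ge0 ?ltW // -sqrtr_sqr.
  congr Num.sqrt; rewrite expr_div_n !exprMn (sqr_sqrtr (ltW rho2)) (sqr_sqrtr (ltW nu0)).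
  by field; rewrite !lt0r_neq0.
have hr0 : 0 < Num.sqrt (1 - rho ^+ 2) by rewrite sqrtr_gt0.
have hn0 : 0 < Num.sqrt (nu%:R : R) by rewrite sqrtr_gt0.
exists theta; split=> //; first by rewrite resid_df_slope subn_gt0.
  by rewrite hse divr_gt0 ?mulr_gt0.
rewrite hse /theta col_mxEd mxE eqxx mulr1n bE.
by field; rewrite !lt0r_neq0.
Qed.

End Slope.
End Ols.

(** * Transfer to coordinates and conclusion *)

Lemma cdot_coord_vec (R : realType) (n r N : nat) (e : 'I_N -> ksub n r)
    (A B : {ffun ksub n r -> R}) :
  bijective e -> cdot (coord_vec e A) (coord_vec e B) = inner A B.
Proof.
move=> he; rewrite cdotE /inner [RHS](reindex e); last exact: onW_bij.
by apply: eq_bigr => i _; rewrite !mxE.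
Qed.

Lemma coord_vec_eq0 (R : realType) (n r N : nat) (e : 'I_N -> ksub n r)
    (A : {ffun ksub n r -> R}) :
  bijective e -> coord_vec e A = 0 -> A = 0.
Proof.
move=> [e' eK e'K] h; apply/ffunP => I; rewrite -[I]e'K ffunE.
by have /colP/(_ (e' I)) := h; rewrite !mxE.
Qed.

Lemma coord_vecB (R : realType) (n r N : nat) (e : 'I_N -> ksub n r)
    (A B : {ffun ksub n r -> R}) :
  coord_vec e (A - B) = coord_vec e A - coord_vec e B.
Proof. by apply/colP => i; rewrite !mxE !ffunE. Qed.

(** Each column of W represents some D^* f, and adjointness moves D onto U A, where it gives 0. *)
Lemma tr_mul_coord_ucenter (R : realType) (n r N k : nat)
    (e : 'I_N -> ksub n r) (W : 'M[R]_(N, k)) (A : {ffun ksub n r -> R}) :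
  (0 < r)%N -> (2 * r <= n)%N -> bijective e ->
  (forall C, (exists gamma, coord_vec e C = W *m gamma) -> lower_anova C) ->
  W^T *m coord_vec e (ucenter A) = 0.
Proof.
move=> hr hn he hW; have [e' eK e'K] := he; apply/colP => j.
pose C : {ffun ksub n r -> R} := [ffun I => W (e' I) j].
have coordC : coord_vec e C = col j W by apply/colP => i; rewrite !mxE ffunE eK.
have [|f hf] := hW C; first by exists (delta_mx j 0); rewrite -colE.
transitivity (cdot (coord_vec e C) (coord_vec e (ucenter A))).
  by rewrite cdotE mxE; apply: eq_bigr => i _; rewrite coordC !mxE.
rewrite cdotC (cdot_coord_vec _ _ he) hf inner_down_adj down_ucenter //.
by rewrite /inner big1 ?mxE // => K _; rewrite ffunE mul0r.
Qed.

Theorem corollary5p3 (R : realType) (n r : nat)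
  (hr : (1 <= r)%N) (hn : (2 * r <= n)%N) (hd : (2 <= dim_top n r)%N)
  (A B : {ffun ksub n r -> R})
  (hA : ucenter A != 0) (hB : ucenter B != 0)
  (e : 'I_('C(n, r)) -> ksub n r) (he : bijective e)
  (W : 'M[R]_('C(n, r), 'C(n, r.-1)))
  (hWrank : \rank W = 'C(n, r.-1))
  (hWcol : forall C : {ffun ksub n r -> R},
     (exists gamma : 'cV[R]_('C(n, r.-1)), coord_vec e C = W *m gamma)
     <-> lower_anova C)
  (hR : `|Rsub A B| < 1) :
  let D : 'M[R]_('C(n, r), 'C(n, r.-1) + 1) := row_mx W (coord_vec e A) in
  let beta : 'I_('C(n, r.-1) + 1) := rshift 'C(n, r.-1) ord0 in
  is_ols_tstat D (coord_vec e B) beta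
    (Num.sqrt ((dim_top n r - 1)%N%:R) * Rsub A B
       / Num.sqrt (1 - Rsub A B ^+ 2))
  /\ resid_df D = (dim_top n r - 1)%N.
Proof.
move=> D beta.
have hL C gamma : coord_vec e C = W *m gamma -> lower_anova C.
  by move=> hC; apply/hWcol; exists gamma.
(* C - U C is lower-order, so its coordinates lie in the column space of W. *)
have split_coord C : exists gamma,
    coord_vec e C = coord_vec e (ucenter C) + W *m gamma.
  have /hWcol [gamma hg] := lower_anova_sub_ucenter C hr.
  by exists gamma; rewrite -hg coord_vecB addrC subrK.
have orth C : W^T *m coord_vec e (ucenter C) = 0.
  by apply: tr_mul_coord_ucenter => // C' [gamma]; apply: hL.
have [g hg] := split_coord A; have [h hh] := split_coord B.
have uA : coord_vec e (ucenter A) != 0.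
  by apply: contra hA => /eqP/(coord_vec_eq0 he)/eqP.
have vB : coord_vec e (ucenter B) != 0.
  by apply: contra hB => /eqP/(coord_vec_eq0 he)/eqP.
have hdim : (dim_top n r - 1 = 'C(n, r) - ('C(n, r.-1) + 1))%N.
  by rewrite /dim_top subnDA.
(* Since [dim_top] is at least 2, its subtraction did not truncate, and a positive residual degree
   of freedom remains. *)
have hlt : ('C(n, r.-1) + 1 < 'C(n, r))%N by move: hd; rewrite /dim_top; lia.
have hRsub : Rsub A B = cdot (coord_vec e (ucenter A)) (coord_vec e (ucenter B)) /
    (Num.sqrt (cdot (coord_vec e (ucenter A)) (coord_vec e (ucenter A))) *
     Num.sqrt (cdot (coord_vec e (ucenter B)) (coord_vec e (ucenter B)))).
  by rewrite !cdot_coord_vec.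
rewrite hdim /D /beta hg hh; split; last exact: resid_df_slope.
by move: hR; rewrite hRsub => hR'; apply: slope_is_ols_tstat.
Qed.
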